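(* Let $p$ be a prime and let $m\ge 1$, $n\ge 1$ be integers. The commuting conjugacy class graph of the group $G(p,m,n)=\langle x,y : x^{p^m}=y^{p^n}=[x,y]^p=1,\ [x,[x,y]]=[y,[x,y]]=1\rangle$ is not CN-hyperenergetic.
   Context: Here $[x,y]$ denotes the commutator of $x$ and $y$. For a finite non-abelian group $G$, the commuting conjugacy class graph $\Gamma(G)$ is the simple undirected graph whose vertices are the conjugacy classes of the non-central elements of $G$; two distinct vertices $a^G$ and $b^G$ are adjacent if there exist $a'\in a^G$, $b'\in b^G$ with $a'b'=b'a'$. For a finite simple graph $\mathcal{G}$ with vertices $v_1,\dots,v_N$, the common neighbourhood matrix $CN(\mathcal{G})$ is the $N\times N$ matrix whose $(i,j)$ entry is, for $i\ne j$, the number of vertices other than $v_i,v_j$ adjacent to both $v_i$ and $v_j$, and is $0$ for $i=j$. The CN-energy $E_{CN}(\mathcal{G})$ is the sum of the absolute values of the eigenvalues of $CN(\mathcal{G})$, counted with multiplicity. With $K_N$ the complete graph on $N=|V(\mathcal{G})|$ vertices, $\mathcal{G}$ is CN-hyperenergetic if $E_{CN}(\mathcal{G})>E_{CN}(K_N)$. *)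

(* Defs.v *)
From HB Require Import structures.
From mathcomp Require Import all_boot all_order all_fingroup all_algebra
  all_solvable all_field.

Set Implicit Arguments.
Unset Strict Implicit.
Unset Printing Implicit Defensive.

Import Order.TTheory GRing.Theory Num.Theory.

Record sgraph := SGraph {
  vertex :> finType;
  adj : rel vertex;
  adj_sym : symmetric adj;
  adj_irr : irreflexive adj }.

Section CommonNeighbourhood.
Local Open Scope ring_scope.

Definition common_nbrs (X : sgraph) (u v : X) : {set X} :=
  [set w | [&& w != u, w != v, adj u w & adj v w]].

Definition CN_mx (X : sgraph) : 'M[algC]_#|X| :=
  \matrix_(i, j) (if i == j then 0
                  else #|common_nbrs (enum_val i) (enum_val j)|%:R).

(* The roots, with multiplicity, of the (monic, hence split over algC)
   characteristic polynomial. *)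
Definition eigenvalues n (A : 'M[algC]_n) : seq algC :=
  sval (closed_field_poly_normal (char_poly A)).

Definition CN_energy (X : sgraph) : algC :=
  \sum_(z <- eigenvalues (CN_mx X)) `|z|.

Lemma complete_sym n : symmetric [rel i j : 'I_n | i != j].
Proof. by move=> i j /=; rewrite eq_sym. Qed.

Lemma complete_irr n : irreflexive [rel i j : 'I_n | i != j].
Proof. by move=> i /=; rewrite eqxx. Qed.

Definition complete_graph n : sgraph :=
  SGraph (@complete_sym n) (@complete_irr n).

(* Both sides are real, so that the partial order of algC compares them as
   real numbers. *)
Definition CN_hyperenergetic (X : sgraph) : bool :=
  CN_energy (complete_graph #|X|) < CN_energy X.

End CommonNeighbourhood.

Section CommutingConjugacyClassGraph.
Local Open Scope group_scope.
Variables (gT : finGroupType) (G : {group gT}).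

Definition noncentral_classes : {set {set gT}} :=
  [set a ^: G | a in G :\: 'Z(G)].

Local Notation ccc_vertex := {C : {set gT} | C \in noncentral_classes}.

Definition ccc_adj : rel ccc_vertex := fun A B =>
  (A != B) && [exists a in val A, exists b in val B, a * b == b * a].

Lemma ccc_adj_sym : symmetric ccc_adj.
Proof.
move=> A B; rewrite /ccc_adj eq_sym; congr (_ && _).
by apply/exists_inP/exists_inP => -[a aA /exists_inP[b bB /eqP ab]];
  exists b => //; apply/exists_inP; exists a => //; rewrite ab.
Qed.

Lemma ccc_adj_irr : irreflexive ccc_adj.
Proof. by move=> A; rewrite /ccc_adj eqxx. Qed.

Definition ccc_graph : sgraph := SGraph ccc_adj_sym ccc_adj_irr.

End CommutingConjugacyClassGraph.

(* Main.v *)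
Require Import Defs.
From mathcomp Require Import all_boot all_order all_fingroup all_algebra
  all_solvable all_field.

(** The commuting conjugacy class graph of the group is a disjoint union of
    complete graphs, and no such graph is CN-hyperenergetic.

    On the group side, c = [x, y] is central, and so are x ^+ p and y ^+ p,
    since [x ^+ p, y] = [x, y ^+ p] = c ^+ p = 1.  Hence G / 'Z(G) is generated
    by two commuting elements of order dividing p: it is abelian, so
    G^`(1) \subset 'Z(G), and its order divides p ^ 2
    ([central_quotient_joing_cycles]).  The centraliser of a noncentral b is
    then proper, so its image in G / 'Z(G) has order 1 or p and is cyclic, and
    the centraliser is abelian ([centraliser_abelian]).  Commutation is
    therefore transitive on noncentral elements.  As conjugates differ by
    central factors, it only depends on the conjugacy classes, and adjacency of
    distinct classes is transitive as well ([ccc_graph_adj_trans]).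

    On the spectral side, two distinct vertices of a clique of size s have
    s - 2 common neighbours, and vertices in different cliques have none.
    The CN-matrix is thus block diagonal with blocks (s - 2)(J - 1), where J
    is the all-ones matrix.  Such a block has the eigenvalue (s - 2)(s - 1) once
    and the eigenvalue - (s - 2) with multiplicity s - 1, so the CN-energy is
    the sum of 2 (s - 1)(s - 2) over the cliques.  It is convenient to choose
    a representative in each clique and to read this number as the sum of
    2 (s - 2) over the vertices that do not represent their clique
    ([CN_energy_cluster]).  Among N > 0 vertices at most N - 1 are of this kind
    and s <= N always, so the energy is at most 2 (N - 1)(N - 2), which is the
    energy of the complete graph. *)

Set Implicit Arguments.
Unset Strict Implicit.
Unset Printing Implicit Defensive.

Import Order.TTheory GRing.Theory Num.Theory.

(** * Spectra of diagonalised matrices *)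

Section Spectrum.
Local Open Scope ring_scope.

(** Stated as an intertwining relation, so that P can be given by eigenvectors
    as columns without computing its inverse. *)
Lemma char_poly_similar (F : fieldType) n (A B P : 'M[F]_n) :
  P \in unitmx -> A *m P = P *m B -> char_poly A = char_poly B.
Proof.
move=> uP eqAB; pose P' := map_mx polyC P.
have eqC: char_poly_mx A *m P' = P' *m char_poly_mx B.
  rewrite /char_poly_mx mulmxBl mulmxBr -!map_mxM eqAB.
  by rewrite scalar_mxC.
have detP : \det P' != 0.
  by rewrite det_map_mx polyC_eq0 -unitfE -unitmxE.
apply: (mulIf detP); rewrite /char_poly -det_mulmx eqC det_mulmx.
by rewrite mulrC.
Qed.

(** The multiplicity of z in either list is its multiplicity as a root of the
    common characteristic polynomial. *)
Lemma eigenvalues_similar_diag n (A P : 'M[algC]_n) (d : 'rV_n) :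
  P \in unitmx -> A *m P = P *m diag_mx d ->
  perm_eq (eigenvalues A) [seq d 0 i | i <- enum 'I_n].
Proof.
move=> uP /(char_poly_similar uP) chiA.
rewrite /eigenvalues; case: closed_field_poly_normal => s /= chi_s.
rewrite (monicP (char_poly_monic A)) scale1r in chi_s.
apply/allP=> z _ /=; rewrite -!mu_prod_XsubC -chi_s chiA.
rewrite char_poly_trig ?is_diag_mx_is_trig ?diag_mx_is_diag //.
rewrite big_map big_enum /=; apply/eqP; congr mup.
by apply: eq_bigr => i _; rewrite mxE eqxx.
Qed.

Lemma sum_enum_val (V : nmodType) (T : finType) (F : T -> V) :
  \sum_(i < #|T|) F (enum_val i) = \sum_x F x.
Proof. by rewrite [RHS](big_enum_val (A := T)). Qed.

End Spectrum.

(** * The weighted block matrix of a partition *)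

Section Cluster.
Local Open Scope ring_scope.

(** A partition of T is encoded by an idempotent f that sends each point to the
    representative of its block; the representatives are the fixed points. *)
Variables (T : finType) (f : T -> T).
Hypothesis f_idem : forall u, f (f u) = f u.

Definition cluster (r : T) : {set T} := [set u | f u == r].

Lemma card_cluster_nonrep r : f r = r ->
  #|[set u | (f u != u) && (f u == r)]| = #|cluster r|.-1.
Proof.
move=> fr; have r_in: r \in cluster r by rewrite inE fr.
rewrite [#|cluster r|](cardsD1 r) r_in /=; apply: eq_card => u; rewrite !inE.
by have [->|//] := eqVneq (f u) r; rewrite ?andbF // eq_sym.
Qed.

(** This is what makes the positive and the negative part of the spectrum of a
    block have the same sum, up to sign. *)
Lemma sum_nonrep (F : T -> nat) :
  (\sum_(u | f u != u) F (f u) = \sum_(r | f r == r) F r * #|cluster r|.-1)%N.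
Proof.
rewrite (partition_big f (fun r => f r == r)) /=; last first.
  by move=> u _; rewrite f_idem.
apply: eq_bigr => r /eqP fr.
rewrite (eq_bigr (fun=> F r)) => [|u /andP[_ /eqP->] //].
rewrite sum_nat_const mulnC -card_cluster_nonrep //; congr (_ * _)%N.
by apply: eq_card => u; rewrite inE.
Qed.

Section Matrix.
Variables (R : numFieldType) (w : T -> R).

Definition cluster_entry (u v : T) : R :=
  if (u != v) && (f u == f v) then w (f u) else 0.

Definition cluster_mx : 'M[R]_#|T| :=
  \matrix_(i, j) cluster_entry (enum_val i) (enum_val j).

(** On a block, J - 1 has the constants and the functions of sum zero as
    eigenspaces.  Attaching to the representative the constant 1, and to any
    other point r of the block its difference with the representative, gives a
    basis of both that is indexed by the points of the block. *)
Definition cluster_eigenvector (r v : T) : R :=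
  if f r == r then (f v == r)%:R else (v == r)%:R - (v == f r)%:R.

Definition cluster_eigenvalue (r : T) : R :=
  if f r == r then w r * #|cluster r|.-1%:R else - w (f r).

Definition cluster_eigenbasis : 'M[R]_#|T| :=
  \matrix_(i, j) cluster_eigenvector (enum_val j) (enum_val i).

(** A function orthogonal to the vectors of the nonrepresentatives is constant
    on blocks; orthogonality to the indicator functions then says that this
    constant times the size of the block vanishes. *)
Lemma cluster_eigenbasis_unit : cluster_eigenbasis \in unitmx.
Proof.
rewrite -row_free_unit; apply: inj_row_free => v vQ0.
pose g x : R := v 0 (enum_rank x).
have gQ r : \sum_x g x * cluster_eigenvector r x = 0.
  have /rowP/(_ (enum_rank r)) := vQ0; rewrite !mxE; apply: etrans.
  rewrite -(sum_enum_val (fun x => g x * cluster_eigenvector r x)).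
  apply: eq_bigr => i _.
  by rewrite mxE enum_rankK /g enum_valK.
have g_f x : g x = g (f x).
  have [-> //|nfx] := eqVneq (f x) x.
  apply/eqP; rewrite -subr_eq0 -[X in _ == X](gQ x) /cluster_eigenvector (negPf nfx).
  under eq_bigr => y _ do rewrite mulrBr !mulr_natr !mulrb.
  by rewrite big_split /= sumrN -!big_mkcond !big_pred1_eq.
have g_rep r : f r = r -> g r = 0.
  move=> fr; have := gQ r; rewrite /cluster_eigenvector fr eqxx.
  under eq_bigr => y _ do rewrite mulr_natr mulrb.
  rewrite -big_mkcond (eq_big (mem (cluster r)) (fun=> g r)) => [|y|y /eqP <-].
  - rewrite sumr_const => /eqP; rewrite mulrn_eq0 => /orP[|/eqP//].
    by rewrite (cardsD1 r) inE fr eqxx.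
  - by rewrite /= inE.
  by rewrite -g_f.
apply/rowP=> i; rewrite mxE -(enum_valK i) -/(g _) g_f.
by rewrite g_rep ?f_idem.
Qed.

Lemma cluster_mx_diag :
  cluster_mx *m cluster_eigenbasis
    = cluster_eigenbasis *m diag_mx (\row_j cluster_eigenvalue (enum_val j)).
Proof.
apply/matrixP=> i j; rewrite mul_mx_diag !mxE.
set u := enum_val i; set r := enum_val j.
under eq_bigr => k _ do rewrite !mxE /=.
rewrite (sum_enum_val (fun x => cluster_entry u x * cluster_eigenvector r x)).
rewrite /cluster_entry /cluster_eigenvector /cluster_eigenvalue.
have [fr|_] := eqVneq (f r) r.
  (* Row u of the product counts the points of the block of r other than u. *)
  have [fu|nfu] := eqVneq (f u) r; last first.
    rewrite mul0r big1 // => x _; case: ifP => [/andP[_ /eqP<-]|_].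
      by rewrite (negPf nfu) mulr0.
    by rewrite mul0r.
  rewrite mul1r (cardsD1 u) inE fu eqxx /= mulr_natr -sumr_const [RHS]big_mkcond /=.
  apply: eq_bigr => x _; rewrite !inE eq_sym [r == _]eq_sym.
  by case: (x != u) => /=; case: eqP => _; rewrite ?mulr1 ?mul0r.
(* Rows r and f r of the block agree except at the two diagonal positions. *)
under eq_bigr => x _ do rewrite mulrBr !mulr_natr !mulrb.
rewrite big_split /= sumrN -!big_mkcond !big_pred1_eq f_idem.
rewrite mulrN -mulNr opprB [u == r]eq_sym.
have [fu|nfu] := eqVneq (f u) (f r); last first.
  rewrite !andbF subrr; have [eru|_] := eqVneq r u.
    by rewrite eru eqxx in nfu.
  have [euf|_] := eqVneq u (f r); last by rewrite subrr mul0r.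
  by rewrite euf f_idem eqxx in nfu.
rewrite !andbT [r == u]eq_sym fu.
case: (u =P r) => _; case: (u =P f r) => _ /=;
  by rewrite ?subrr ?sub0r ?subr0 ?mul0r ?mul1r ?mulN1r.
Qed.

End Matrix.
End Cluster.

(** * CN-energy of disjoint unions of complete graphs *)

Section Energy.
Local Open Scope ring_scope.

(** The truncated subtraction is harmless: for a singleton block the weight
    s - 2 = -1 is replaced by 0, but it only multiplies s - 1 = 0. *)
Lemma CN_energy_cluster (X : sgraph) (f : X -> X) :
  (forall u, f (f u) = f u) ->
  (forall u v, adj u v = (u != v) && (f u == f v)) ->
  CN_energy X = (2 * \sum_(u | f u != u) (#|cluster f (f u)| - 2))%N%:R.
Proof.
move=> f_idem adjE; pose w r : algC := (#|cluster f r| - 2)%N%:R.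
have CN_E : CN_mx X = cluster_mx f w.
  apply/matrixP=> i j; rewrite !mxE -(inj_eq enum_val_inj).
  move: (enum_val i) (enum_val j) => u v.
  rewrite /cluster_entry; have [<-|nuv] := eqVneq u v; first by [].
  have [fuv|nfuv] /= := eqVneq (f u) (f v).
    have -> : common_nbrs u v = cluster f (f u) :\ u :\ v.
      apply/setP=> x; rewrite !inE !adjE fuv.
      rewrite (eq_sym u) (eq_sym v) (eq_sym (f v)).
      by case: (x == u) (x == v) => [] [] //=; rewrite andbb.
    have u_in : u \in cluster f (f u) by rewrite inE.
    have v_in : v \in cluster f (f u) :\ u by rewrite !inE eq_sym nuv fuv eqxx.
    rewrite /w (cardsD1 u (cluster _ _)) u_in (cardsD1 v (_ :\ u)) v_in.
    by rewrite addnA addKn.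
  suff ->: common_nbrs u v = set0 by rewrite cards0.
  apply/setP=> x; rewrite !inE !adjE; apply/negP.
  case/and4P=> _ _ /andP[_ /eqP fux] /andP[_ /eqP fvx].
  by rewrite fux fvx eqxx in nfuv.
have uQ := cluster_eigenbasis_unit f_idem algC.
have := eigenvalues_similar_diag uQ (cluster_mx_diag f_idem w).
rewrite -CN_E /CN_energy => /(perm_big _) ->.
rewrite big_map big_enum /=.
under eq_bigr => i _ do rewrite mxE.
rewrite (sum_enum_val (fun x => `|cluster_eigenvalue f w x|)).
rewrite (bigID (fun r => f r == r)) /= mul2n -addnn natrD; congr (_ + _).
  (* The representatives carry the positive eigenvalues, whose sum is that of
     the absolute values of the others. *)
  rewrite (sum_nonrep f_idem (fun r => #|cluster f r| - 2)%N) natr_sum.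
  by apply: eq_bigr => r fr; rewrite /cluster_eigenvalue fr /w -natrM normr_nat.
rewrite natr_sum; apply: eq_bigr => u nfu.
by rewrite /cluster_eigenvalue (negPf nfu) normrN normr_nat.
Qed.

(** The complete graph is a single block, represented by any of its vertices;
    the formula gives 0 for the empty graph too. *)
Lemma CN_energy_complete n :
  CN_energy (complete_graph n) = (2 * (n.-1 * (n - 2)))%N%:R.
Proof.
case: n => [|n].
  by rewrite (@CN_energy_cluster _ id) // ?big1 // => u; case: u.
rewrite (@CN_energy_cluster (complete_graph n.+1) (fun=> ord0)) //=; last first.
  by move=> u v; rewrite eqxx andbT.
rewrite sum_nat_const; congr (2 * (_ * (_ - _)))%N%:R.
  transitivity #|[set~ ord0 : 'I_n.+1]|; last by rewrite cardsC1 card_ord.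
  by apply: eq_card => i; rewrite !inE eq_sym.
by rewrite -[RHS](card_ord n.+1); apply: eq_card => i; rewrite inE eqxx.
Qed.

(** Each block has at most #|X| points, and at least one point of X is the
    representative of its block as soon as X is not empty. *)
Lemma cluster_graph_not_CN_hyperenergetic (X : sgraph) (f : X -> X) :
  (forall u, f (f u) = f u) ->
  (forall u v, adj u v = (u != v) && (f u == f v)) ->
  ~~ CN_hyperenergetic X.
Proof.
move=> f_idem adjE; rewrite /CN_hyperenergetic CN_energy_complete.
rewrite (CN_energy_cluster f_idem adjE) ltr_nat -leqNgt leq_mul2l /=.
apply: (@leq_trans (\sum_(u | f u != u) (#|X| - 2))).
  by apply: leq_sum => u _; rewrite leq_sub2r // max_card.
rewrite sum_nat_const leq_mul2r; apply/orP; right.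
have [u _|noX] := pickP X; last by rewrite eq_card0 // => u; have := noX u.
rewrite -(cardsC1 (f u)); apply: subset_leq_card; apply/subsetP=> x.
by rewrite !inE; apply: contraNneq => ->; rewrite f_idem.
Qed.

(** The blocks are the connected components, whose canonical representatives
    are provided by [fingraph.root]. *)
Lemma transitive_adj_not_CN_hyperenergetic (X : sgraph) :
  (forall u v x : X, adj u v -> adj v x -> u != x -> adj u x) ->
  ~~ CN_hyperenergetic X.
Proof.
move=> adj_trans; pose e : rel X := @adj X.
have sym_e : connect_sym e.
  by apply: sym_connect_sym; apply: adj_sym.
apply: (@cluster_graph_not_CN_hyperenergetic _ (fingraph.root e)) => [u|u v].
  by apply/eqP/(roots_root sym_e).
rewrite (root_connect sym_e); apply/idP/andP=> [auv | [nuv /connectP[s]]].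
  split; last exact: connect1.
  by apply: contraTneq auv => ->; rewrite adj_irr.
elim: s u nuv => [|x s IHs] u nuv /=; first by move=> _ euv; rewrite euv eqxx in nuv.
case/andP=> aux es ev; have [exv|nxv] := eqVneq x v; first by rewrite -exv.
exact: adj_trans aux (IHs _ nxv es ev) nuv.
Qed.

End Energy.

(** * Commutation of noncentral elements *)

Section Groups.
Local Open Scope group_scope.
Variables (gT : finGroupType) (G : {group gT}).

(** A conjugate of a is a * [a, g] with [a, g] central, and central factors do
    not affect commutation; the representatives are thus immaterial. *)
Lemma ccc_adj_reps (a b : gT) (A B : ccc_graph G) :
    G^`(1) \subset 'Z(G) -> a \in G -> b \in G ->
    val A = a ^: G -> val B = b ^: G ->
  adj A B = (A != B) && (a * b == b * a).
Proof.
move=> sG'Z aG bG eA eB; rewrite /= /ccc_adj eA eB; congr (_ && _).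
have conj_central x g : x \in G -> g \in G -> exists2 z, z \in 'Z(G) & x ^ g = x * z.
  move=> xG gG; exists [~ x, g]; last by rewrite commgEl mulKVg.
  by apply: (subsetP sG'Z); apply: mem_commg.
apply/exists_inP/idP=> [[_ /imsetP[g gG ->]] | ab]; last first.
  exists a; first exact: class_refl.
  by apply/exists_inP; exists b; first exact: class_refl.
case/exists_inP=> _ /imsetP[h hG ->].
have [z /centerP[zG cz] ->] := conj_central a g aG gG.
have [t /centerP[tG ct] ->] := conj_central b h bG hG.
have zb := cz _ bG; have ta := ct _ aG.
have -> : a * z * (b * t) = (a * b) * (z * t).
  by rewrite -!mulgA; congr (_ * _); rewrite !mulgA zb.
have -> : b * t * (a * z) = (b * a) * (z * t).
  by rewrite -!mulgA; congr (_ * _); rewrite !mulgA ta -!mulgA (cz t).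
by rewrite (inj_eq (mulIg _)).
Qed.

(** The image of the centraliser in G / 'Z(G) has order dividing p ^ 2.  It is
    not the whole quotient because b is not central, so its order is 1 or p and
    it is cyclic; and a group that is cyclic modulo a central subgroup is
    abelian. *)
Lemma centraliser_abelian (p : nat) (b : gT) :
  prime p -> #|G / 'Z(G)| %| p ^ 2 -> b \in G :\: 'Z(G) -> abelian 'C_G[b].
Proof.
move=> p_pr cardGZ /setDP[bG nbZ].
have sCG : 'C_G[b] \subset G := subsetIl _ _.
have nsZG : 'Z(G) <| G := center_normal G.
have sZC : 'Z(G) \subset 'C_G[b].
  apply/subsetP=> z /centerP[zG cz]; apply/subcent1P; split=> //.
  exact/commute_sym/cz.
have sZZC : 'Z(G) \subset 'Z('C_G[b]).
  by rewrite subsetI sZC (subset_trans (subsetIr _ _)) // centS.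
apply: (cyclic_factor_abelian sZZC).
have sCZ : 'C_G[b] / 'Z(G) \subset G / 'Z(G) by apply: quotientS.
have /(dvdn_pfactor _ _ p_pr)[k lek2 cardC] := dvdn_trans (cardSg sCZ) cardGZ.
have ltk2 : k < 2.
  rewrite ltn_neqAle lek2 andbT; apply: contraNneq nbZ => k2.
  have eqCZ : 'C_G[b] / 'Z(G) = G / 'Z(G).
    apply/eqP; rewrite eqEcard sCZ cardC k2.
    by rewrite dvdn_leq // expn_gt0 prime_gt0.
  have sGC : G \subset 'C_G[b].
    rewrite -(quotientSGK _ sZC) ?eqCZ //.
    exact: normal_norm nsZG.
  rewrite inE bG /= -sub_cent1.
  by apply: subset_trans sGC (subsetIr _ _).
case: k ltk2 {lek2} cardC => [|[|//]] _ cardC.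
  have /eqP-> : 'C_G[b] / 'Z(G) == 1 by rewrite trivg_card1 cardC.
  exact: cyclic1.
by rewrite prime_cyclic // cardC expn1.
Qed.

(** Elements commuting with a noncentral b commute with each other, since they
    lie in its abelian centraliser. *)
Lemma ccc_graph_adj_trans (p : nat) :
    prime p -> #|G / 'Z(G)| %| p ^ 2 -> G^`(1) \subset 'Z(G) ->
  forall A B C : ccc_graph G, adj A B -> adj B C -> A != C -> adj A C.
Proof.
move=> p_pr cardGZ sG'Z A B C.
have [/imsetP[a Ga eA] /imsetP[b Gb eB]] := (valP A, valP B).
have /imsetP[c Gc eC] := valP C.
have [[aG _] [cG _]] := (setDP Ga, setDP Gc).
have bG : b \in G by have [] := setDP Gb.
rewrite (ccc_adj_reps sG'Z aG bG eA eB) (ccc_adj_reps sG'Z bG cG eB eC).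
rewrite (ccc_adj_reps sG'Z aG cG eA eC) => /andP[_ /eqP ab] /andP[_ /eqP bc] ->.
have /centsP cCC := centraliser_abelian p_pr cardGZ Gb.
by apply/eqP/cCC; apply/subcent1P.
Qed.

Lemma mem_center_joing_cycles (x y z : gT) :
  <[x]> <*> <[y]> = G -> z \in G -> commute z x -> commute z y -> z \in 'Z(G).
Proof.
move=> defG zG zx zy; rewrite inE zG -sub_cent1 -defG join_subG !cycle_subG /=.
by apply/andP; split; apply/cent1P/commute_sym.
Qed.

(** The powers x ^+ p and y ^+ p commute with both generators because the
    commutator [~ x, y] is central of order dividing p. *)
Lemma central_quotient_joing_cycles (p : nat) (x y : gT) :
    <[x]> <*> <[y]> = G -> [~ x, y] ^+ p = 1 ->
    [~ x, [~ x, y]] = 1 -> [~ y, [~ x, y]] = 1 ->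
  #|G / 'Z(G)| %| p ^ 2 /\ G^`(1) \subset 'Z(G).
Proof.
move=> defG zp1 /eqP/commgP xz /eqP/commgP yz.
have nZG : G \subset 'N('Z(G)) := normal_norm (center_normal G).
have [xG yG] : x \in G /\ y \in G.
  by rewrite -defG; split; apply: mem_gen; rewrite inE cycle_id ?orbT.
have [nx ny] := (subsetP nZG x xG, subsetP nZG y yG).
have mem_Z := mem_center_joing_cycles defG.
have zZ : [~ x, y] \in 'Z(G).
  by apply: mem_Z; rewrite ?groupR //; apply: commute_sym.
have xpZ : x ^+ p \in 'Z(G).
  apply: mem_Z; rewrite ?groupX //; first exact/commute_sym/commuteX.
  by apply/commgP; rewrite commXg // zp1.
have ypZ : y ^+ p \in 'Z(G).
  apply: mem_Z; rewrite ?groupX //; last exact/commute_sym/commuteX.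
  by apply/commute_sym/commgP; rewrite commgX // zp1.
set x' := coset 'Z(G) x; set y' := coset 'Z(G) y.
have defGZ : G / 'Z(G) = <[x']> <*> <[y']>.
  by rewrite -!quotient_cycle // -quotientY ?cycle_subG // defG.
have cxy : <[y']> \subset 'C(<[x']>).
  apply/cents_cycle/commute_sym/commgP.
  by rewrite -morphR //= coset_id.
have order_dvd w : w \in 'N('Z(G)) -> w ^+ p \in 'Z(G) -> #|<[coset 'Z(G) w]>| %| p.
  by move=> nw wpZ; rewrite order_dvdn -morphX //= coset_id.
split; last first.
  apply: der1_min nZG _.
  by rewrite defGZ abelianY !cycle_abelian.
rewrite defGZ (cent_joinEr cxy) /=.
apply: (@dvdn_trans (#|<[x']>| * #|<[y']>|)); first by rewrite mul_cardG dvdn_mulr.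
by rewrite expnS expn1 dvdn_mul // order_dvd.
Qed.

End Groups.

Local Open Scope group_scope.

Theorem theorem3p5 (p m n : nat) (hp : prime p) (hm : (1 <= m)%N) (hn : (1 <= n)%N)
    (gT : finGroupType) (G : {group gT})
    (hG : G \isog Grp (x : y :
       x ^+ (p ^ m)%N = y ^+ (p ^ n)%N = 1, [~ x, y] ^+ p = 1,
       [~ x, [~ x, y]] = [~ y, [~ x, y]] = 1)) :
  ~ CN_hyperenergetic (ccc_graph G).
Proof.
have /existsP[[x y] /eqP[defG _ _ zp1 xz1 yz1]] := isoGrp_hom hG.
have [cardGZ sG'Z] := central_quotient_joing_cycles defG zp1 xz1 yz1.
apply/negP/transitive_adj_not_CN_hyperenergetic.
exact: ccc_graph_adj_trans hp cardGZ sG'Z.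
Qed.
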